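(* Let $\mathcal Z\subseteq\mathbb R^d$ be compact and convex, $\ell:\mathcal Z\to\mathbb R$ upper semicontinuous, $\phi$ an entropy function, $r\ge0$, $\epsilon\in(0,1)$, and $\hat\mu=\frac1n\sum_{i=1}^n\delta_{\hat z_i}$ with $\hat z_i\in\mathcal Z$. Let $\hat z_{n+1}\in\arg\max_{z\in\mathcal Z}\ell(z)$ with $\hat z_{n+1}\notin\{\hat z_1,\dots,\hat z_n\}$. Take $\mathcal V=\mathcal Z$, $\mathcal W=\mathbb R_+$, $\mathcal G$ the trivial $\sigma$-algebra, $f(v,w)=\ell(v)\,w$, $$\hat\nu=\frac{1-\epsilon}{n}\sum_{i=1}^n\delta_{(\hat z_i,\frac{1}{1-\epsilon})}+\epsilon\,\delta_{(\hat z_{n+1},0)},$$ and the cost $c((v,w),(\hat v,\hat w))=\infty\cdot\mathbb 1_{v\neq\hat v}+g(v)\,\phi\big(w/g(v)\big)$, where $g(v)=\frac1{1-\epsilon}$ if $v\in\{\hat z_1,\dots,\hat z_n\}$, $g(\hat z_{n+1})=0$, and $g(v)=+\infty$ otherwise; explicitly, $c((v,w),(\hat v,\hat w))=\frac1{1-\epsilon}\phi((1-\epsilon)w)$ if $v=\hat v\in\{\hat z_1,\dots,\hat z_n\}$, $=\phi'_\infty\cdot w$ if $v=\hat v=\hat z_{n+1}$, and $=+\infty$ otherwise. Then the OT-DRO problem with conditional moment constraints $\sup\{\mathbb E_\nu[f(V,W)]:\nu\in\mathcal P(\mathcal V\times\mathcal W),\ \mathbb M(\nu,\hat\nu)\le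 r\}$ has the same optimal value as the generalized $\phi$-divergence DRO problem $\sup_{\mu\in\mathcal P(\mathcal Z)}\{\mathbb E_\mu[\ell(Z)]:\mathbb D_\phi(\mu,\hat\mu)\le r\}$.
   Context: An entropy function is a lower semicontinuous convex $\phi:\mathbb R\to\mathbb R\cup\{+\infty\}$ with $\phi(1)=0$, $\mathrm{dom}(\phi)\subseteq\mathbb R_+$, $\mathrm{dom}(\phi)\cap\mathbb R_+\ne\emptyset$; $\phi'_\infty=\lim_{t\to\infty}\phi(t)/t$. Generalized $\phi$-divergence: for any measure $\rho$ dominating $\mu$ and $\hat\mu$, $\mathbb D_\phi(\mu,\hat\mu)=\int\frac{d\hat\mu}{d\rho}\,\phi\big(\frac{d\mu}{d\rho}/\frac{d\hat\mu}{d\rho}\big)d\rho$, with conventions $\phi(0)=\lim_{t\to0^+}\phi(t)$, $0\cdot\phi(0/0)=0$, $0\cdot\phi(\alpha/0)=\alpha\phi'_\infty$ ($\alpha>0$). Extended arithmetic: $\infty\cdot0=0\cdot\infty=0/0=0$, $\infty-\infty=1/0=\infty$. OT discrepancy with conditional moment constraints: let $\mathcal V\subseteq\mathbb R^{d_v}$ and $\mathcal W\subseteq\mathbb R_+$ be closed convex sets, let $(V,W,\hat V,\hat W)$ denote the coordinate random variables on $(\mathcal V\times\mathcal W)\times(\mathcal V\times\mathcal W)$, let $\mathcal G$ be a sub-$\sigma$-algebra (here trivial), and let $c$ be a lower semicontinuous cost on $(\mathcal V\times\mathcal W)^2$ with values in $\mathbb R\cup\{+\infty\}$. For $\nu,\hat\nu\in\mathcal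 P(\mathcal V\times\mathcal W)$, $\mathbb M(\nu,\hat\nu)=\inf\{\mathbb E_\pi[c((V,W),(\hat V,\hat W))]:\ \pi\in\mathcal P((\mathcal V\times\mathcal W)^2),\ \pi_{(V,W)}=\nu,\ \pi_{(\hat V,\hat W)}=\hat\nu,\ \mathbb E_\pi[W\mid\mathcal G]=1\ \pi\text{-a.s.}\}$, where $\pi_{(V,W)},\pi_{(\hat V,\hat W)}$ are the marginals of $\pi$. When $\mathcal G$ is trivial the constraint reads $\mathbb E_\pi[W]=1$. *)

(* Defs.v *)
From HB Require Import structures.
From mathcomp Require Import all_boot all_order all_algebra.
From mathcomp Require Import all_classical all_reals all_analysis.
Set Implicit Arguments. Unset Strict Implicit. Unset Printing Implicit Defensive.
Import Order.TTheory GRing.Theory Num.Theory.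
Import numFieldNormedType.Exports.
Local Open Scope classical_set_scope.
Local Open Scope ring_scope.

Definition Rd (R : realType) (d : nat) :=
  g_sigma_algebraType (@open 'rV[R]_d).

Section defs.
Context (R : realType).
Local Open Scope ereal_scope.

(* Expectation of an extended-real function, with the paper's
   convention oo - oo = oo : E[f] = E[f^+] - E[f^-]. *)
Definition Eext d (T : measurableType d) (mu : set T -> \bar R)
    (f : T -> \bar R) : \bar R :=
  let a := \int[mu]_x (f^\+ x) in
  let b := \int[mu]_x (f^\- x) in
  if a == +oo then +oo else a - b.

Definition entropy_fun (phi : R -> \bar R) : Prop :=
  lower_semicontinuous phi /\
  (forall x y t : R, (0 < t < 1)%R ->
     phi ((1 - t) * x + t * y)%R <= ((1 - t)%:E * phi x + t%:E * phi y)) /\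
  phi 1%R = 0 /\
  (forall t : R, phi t != -oo) /\
  (forall t : R, (t < 0)%R -> phi t = +oo) /\
  (exists t : R, (0 <= t)%R /\ phi t < +oo).

Definition phi_slope_inf (phi : R -> \bar R) : \bar R :=
  lim ((fun t : R => phi t * (t^-1)%:E) @ +oo%R).

(* integrand q * phi(p/q) with the conventions 0 phi(0/0) = 0 and
   0 phi(a/0) = a phi'_oo *)
Definition div_integrand (phi : R -> \bar R) (p q : R) : \bar R :=
  if (0 < q)%R then q%:E * phi (p / q)%R
  else if (0 < p)%R then p%:E * phi_slope_inf phi
  else 0.

(* Generalized phi-divergence D_phi(mu, muhat): for any measure rho
   dominating mu and muhat, with densities p = dmu/drho, q = dmuhat/drho,
   D = int q phi(p/q) drho.  This value does not depend on rho; we take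
   the infimum over all such representations (all give the same value). *)
Definition phi_div d (T : measurableType d) (phi : R -> \bar R)
    (mu muhat : set T -> \bar R) : \bar R :=
  ereal_inf [set v | exists (rho : {measure set T -> \bar R}) (p q : T -> R),
    [/\ measurable_fun setT p, measurable_fun setT q,
        (forall x, (0 <= p x)%R), (forall x, (0 <= q x)%R)
      & [/\ (forall A, measurable A -> mu A = \int[rho]_(x in A) (p x)%:E),
        (forall A, measurable A -> muhat A = \int[rho]_(x in A) (q x)%:E)
      & v = Eext rho (fun x => div_integrand phi (p x) (q x))]]].

(* OT discrepancy with (trivial-G) conditional moment constraint
   E_pi[W] = 1, on the space (V x W) x (V x W), V x W embedded in T * R. *)
Definition OT_moment d (T : measurableType d)
    (c : (T * R) * (T * R) -> \bar R)
    (nu nuhat : set (T * R) -> \bar R) : \bar R :=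
  ereal_inf [set v | exists pi : probability ((T * R) * (T * R))%type R,
    [/\ (forall A, measurable A -> pi (fst @^-1` A) = nu A),
        (forall A, measurable A -> pi (snd @^-1` A) = nuhat A),
        Eext pi (fun x => (x.1.2)%:E) = 1
      & v = Eext pi c]].

End defs.

Section problem.
Context (R : realType) (d n : nat).
Local Open Scope ereal_scope.

Definition usc_on (Z : set 'rV[R]_d) (l : 'rV[R]_d -> R) : Prop :=
  forall z, Z z -> forall a : R, (l z < a)%R ->
    \forall y \near z, Z y -> (l y < a)%R.

Definition muhat (zh : 'I_n -> 'rV[R]_d) : set (Rd R d) -> \bar R :=
  fun A => ((n%:R)^-1 * \sum_(i < n) \1_A (zh i : Rd R d))%:E.

Definition nuhat (eps : R) (zh : 'I_n -> 'rV[R]_d) (zn1 : 'rV[R]_d) :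
    set (Rd R d * R)%type -> \bar R :=
  fun A => ((1 - eps) / n%:R *
              \sum_(i < n) \1_A ((zh i : Rd R d), (1 - eps)^-1)
            + eps * \1_A ((zn1 : Rd R d), 0))%:E.

Definition cost (phi : R -> \bar R) (eps : R) (zh : 'I_n -> 'rV[R]_d)
    (zn1 : 'rV[R]_d) (x : (Rd R d * R) * (Rd R d * R)) : \bar R :=
  let v := x.1.1 in let w := x.1.2 in let vh := x.2.1 in
  if (v == vh) && [exists i : 'I_n, v == zh i] then
    ((1 - eps)^-1)%:E * phi ((1 - eps) * w)%R
  else if (v == vh) && (v == zn1) then phi_slope_inf phi * w%:E
  else +oo.

End problem.

(* Main.v *)
Require Import Defs.
From HB Require Import structures.
From mathcomp Require Import all_boot all_order all_algebra.
From mathcomp Require Import all_classical all_reals all_analysis.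
From mathcomp Require Import measurable_realfun ring lra.
Import Order.TTheory GRing.Theory Num.Theory.
Import numFieldNormedType.Exports.
Local Open Scope classical_set_scope.
Local Open Scope ring_scope.
Set Implicit Arguments.
Unset Strict Implicit.

(** Both problems reduce to the same finite one: choose a density [p >= 0] on the
    atoms with [n^-1 sum_i p(z_i) + p(z_{n+1}) = 1] and
    [n^-1 sum_i phi(p(z_i)) + phi'_oo p(z_{n+1}) <= r], and maximize
    [n^-1 sum_i l(z_i) p(z_i) + l(z_{n+1}) p(z_{n+1})].

    - Divergence side: on the atoms of the reference measure the integrand is
      determined by the atom masses, and all the mass of [mu] elsewhere costs
      [phi'_oo] per unit, so that moving it to the maximizer [z_{n+1}] keeps the
      divergence and does not decrease the expectation of [l].
    - Transport side: a coupling of finite cost satisfies [V = Vhat], hence the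
      law of [V] is the fixed atomic one.  Averaging [W] over each atom keeps the
      objective and, by Jensen's inequality, does not increase the cost.

    Jensen's inequality is used through affine minorants: for every real
    [y < phi(s)] there is an affine function below [phi] taking the value [y] at
    [s], and integrating affine functions is linear.  This also handles infinite
    values and the infimum over couplings (or over dominating measures). *)

(** * Extended-real expectations, compared up to null sets *)

Section expectation.
Local Open Scope ereal_scope.
Context (R : realType) d (T : measurableType d) (mu : {measure set T -> \bar R}).
Import HBNNSimple.

(* Integrals of nonnegative functions are suprema over simple functions, so
   that neither [f] nor [g] has to be measurable. *)
Lemma ge0_le_integral_off (N : set T) (f g : T -> \bar R) :
    measurable N -> mu N = 0 -> (forall x, 0 <= f x) -> (forall x, 0 <= g x) ->
    (forall x, ~ N x -> f x <= g x) ->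
  \int[mu]_x f x <= \int[mu]_x g x.
Proof.
move=> mN muN f0 g0 fg; rewrite ge0_integralTE//.
apply: ge_ereal_sup => _ [h /= hf <-].
rewrite -integralT_nnsfun (ge0_negligible_integral mN)//; last 2 first.
- exact/measurable_EFinP.
- by move=> x _; rewrite lee_fin.
have mNT : measurable (setT `\` N) by exact: measurableD.
rewrite integral_nnsfun// ge0_integralTE//.
rewrite (_ : patch _ _ _ = proj_nnsfun h mNT); last first.
  by apply/funext => x; rewrite patch_indic.
apply: ereal_sup_ubound; exists (proj_nnsfun h mNT) => // x /=.
rewrite mindicE; have [/set_mem[_ Nx]|_] := boolP (x \in _).
  by rewrite mulr1 (le_trans (hf x))// fg.
by rewrite mulr0.
Qed.

(** Positive parts are ordered one way, negative parts the other. If the positive part of [f] has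
    infinite integral, so has that of [g], and both values are [+oo]; otherwise the differences
    compare termwise. *)
Lemma le_Eext_off (N : set T) (f g : T -> \bar R) :
    measurable N -> mu N = 0 -> (forall x, ~ N x -> f x <= g x) ->
  Eext mu f <= Eext mu g.
Proof.
move=> mN muN fg; rewrite /Eext.
have fg' : {in ~` N, forall x, f x <= g x} by move=> x /set_mem/fg.
have le_pos : \int[mu]_x f^\+ x <= \int[mu]_x g^\+ x.
  apply: (ge0_le_integral_off mN muN) => // x Nx.
  by apply: (funepos_le fg'); exact: mem_set.
have le_neg : \int[mu]_x g^\- x <= \int[mu]_x f^\- x.
  apply: (ge0_le_integral_off mN muN) => // x Nx.
  by apply: (funeneg_le fg'); exact: mem_set.
case: ifPn => [/eqP foo|foo].
  by move: le_pos; rewrite foo leye_eq => /eqP ->; rewrite eqxx.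
by case: ifPn => [_|_]; [rewrite leey|rewrite leeB].
Qed.

Lemma eq_Eext_off (N : set T) (f g : T -> \bar R) :
    measurable N -> mu N = 0 -> (forall x, ~ N x -> f x = g x) ->
  Eext mu f = Eext mu g.
Proof.
by move=> mN muN fg; apply/eqP; rewrite eq_le; apply/andP; split;
  apply: (le_Eext_off mN muN) => x /fg ->.
Qed.

Lemma Eext_integrable (f : T -> \bar R) :
  mu.-integrable setT f -> Eext mu f = \int[mu]_x f x.
Proof.
move=> intf; rewrite /Eext [RHS]integralE ifF//.
by apply/negbTE; rewrite -ltey; exact: integral_funepos_lt_pinfty.
Qed.

Lemma Eext_lty_integral_pos (f : T -> \bar R) :
  Eext mu f < +oo -> \int[mu]_x f^\+ x < +oo.
Proof. by rewrite /Eext; case: ifPn => [_|ne _]; [rewrite ltxx|rewrite ltey]. Qed.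

(** An infinite positive part gives [+oo] by convention, and an infinite negative part alone gives
    [-oo]; a finite value excludes both. *)
Lemma Eext_fin_integrable (f : T -> R) (v : R) : measurable_fun setT f ->
  Eext mu (EFin \o f) = v%:E -> mu.-integrable setT (EFin \o f).
Proof.
move=> mf Efv; have mEf : measurable_fun setT (EFin \o f) by exact/measurable_EFinP.
have pos_lty : \int[mu]_x (EFin \o f)^\+ x < +oo.
  by apply: Eext_lty_integral_pos; rewrite Efv ltry.
apply/integrableP; split => //.
under eq_integral do rewrite -/((abse \o (EFin \o f)) _) fune_abse.
rewrite ge0_integralD//; [|exact: measurable_funepos|exact: measurable_funeneg].
rewrite lte_add_pinfty// ltey; apply/eqP => negoo.
by move: Efv; rewrite /Eext (lt_eqF pos_lty) negoo addeNy.
Qed.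

Lemma Eext_pushforward d' (U : measurableType d') (pi : {measure set U -> \bar R})
    (g : U -> T) (f : T -> \bar R) :
    measurable_fun setT g -> measurable_fun setT f ->
    (forall A, measurable A -> pi (g @^-1` A) = mu A) ->
  Eext mu f = Eext pi (f \o g).
Proof.
move=> mg mf piE.
have push (h : T -> \bar R) : measurable_fun setT h -> (forall x, 0 <= h x) ->
    \int[mu]_x h x = \int[pi]_u h (g u).
  move=> mh h0; rewrite -(@ge0_integral_pushforward _ _ _ _ _ _ mg pi setT)//.
  by apply: eq_measure_integral => A mA _; rewrite -piE.
rewrite /Eext (push f^\+)//; last exact: measurable_funepos.
rewrite (push f^\-)//; last exact: measurable_funeneg.
have -> : (f \o g)^\+ = f^\+ \o g by apply/funext => u; rewrite /= !funeposE.
by have -> : (f \o g)^\- = f^\- \o g by apply/funext => u; rewrite /= !funenegE.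
Qed.

End expectation.

(** * Entropy functions: affine minorants and slope at infinity *)

Section entropy.
Local Open Scope ereal_scope.
Context (R : realType) (phi : R -> \bar R).
Hypothesis phi_entropy : entropy_fun phi.

Let phi_lsc : lower_semicontinuous phi. Proof. by case: phi_entropy. Qed.
Let phi_gtNy t : phi t != -oo. Proof. by case: phi_entropy => _ [_ [_ []]]. Qed.
Let phi1 : phi 1%R = 0. Proof. by case: phi_entropy => _ [_ []]. Qed.

Let phi_fin t : phi t < +oo -> phi t = (fine (phi t))%:E.
Proof. by move=> h; rewrite fineK// fin_numE phi_gtNy -ltey. Qed.

Let phi_ball (s y : R) : y%:E < phi s ->
  exists2 e : R, (0 < e)%R & forall t, (`|t - s| < e)%R -> y%:E < phi t.
Proof.
move=> /phi_lsc[V /nbhs_ballP[e /= e0 eV] Vy]; exists e => // t ts.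
by apply/Vy/eV; rewrite /ball/= distrC.
Qed.

Let phi_conv (x y t : R) : (0 < t < 1)%R -> phi x < +oo -> phi y < +oo ->
  phi ((1 - t) * x + t * y)%R
    <= ((1 - t) * fine (phi x) + t * fine (phi y))%R%:E.
Proof.
move=> t01 xoo yoo; case: phi_entropy => _ [/(_ x y t t01) + _].
by rewrite {1}(phi_fin xoo) {1}(phi_fin yoo).
Qed.

(* Convexity propagates the lower bound -1 near 1, where phi vanishes, to a
   bound of linear growth. *)
Let phi_growth : exists2 K : R, (0 <= K)%R &
  forall t, (- K * `|t - 1| - 1)%R%:E <= phi t.
Proof.
have : (-1)%R%:E < phi 1%R by rewrite phi1 lte_fin; lra.
move=> /phi_ball[e e0 ephi]; exists (2 / e)%R; first by rewrite divr_ge0// ltW.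
move=> t; have K0 : (0 <= 2 / e * `|t - 1|)%R.
  by rewrite mulr_ge0// divr_ge0// ltW.
have [te|te] := ltP `|t - 1|%R e.
  by apply: le_trans (ltW (ephi _ te)); rewrite lee_fin; lra.
have [toy|] := ltP (phi t) +oo; last by rewrite leye_eq => /eqP ->; rewrite leey.
have t10 : (0 < `|t - 1|)%R by exact: lt_le_trans te.
(* The point [(1 - u) * 1 + u * t] is at distance [e / 2] from 1, where the bound -1 is
   available. *)
pose u : R := (e / (2 * `|t - 1|))%R.
have ue : (u * `|t - 1| = e / 2)%R by rewrite /u; field; rewrite gt_eqF.
have u01 : (0 < u < 1)%R.
  by rewrite divr_gt0 ?mulr_gt0//= ltr_pdivrMr ?mulr_gt0//; lra.
have := @phi_conv 1%R t u u01; rewrite phi1 => /(_ (ltry _) toy).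
have : (`|((1 - u) * 1 + u * t) - 1| < e)%R.
  rewrite (_ : _ - 1 = u * (t - 1))%R; last by ring.
  by rewrite normrM (gtr0_norm (andP u01).1) ue; lra.
move=> /ephi /lt_le_trans /[apply]; rewrite lte_fin => h.
rewrite (phi_fin toy) lee_fin.
have {h} h : (-1 < u * fine (phi t))%R by move: h; rewrite /=; lra.
have uK : (u * (- (2 / e) * `|t - 1|) = -1)%R.
  by rewrite /u; field; rewrite !gt_eqF.
have : (u * (- (2 / e) * `|t - 1|) < u * fine (phi t))%R by rewrite uK.
by rewrite ltr_pM2l ?(andP u01).1//; lra.
Qed.

(** The line passes through [(s, y)], strictly below the graph, so it exists even where [phi s] is
    infinite or [phi] has no subgradient. Its slope is the supremum of the slopes of chords from the
    left, which convexity keeps below those of chords to the right. *)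
Lemma entropy_affine_minorant (s y : R) : y%:E < phi s ->
  exists A B : R, (forall t, (A * t + B)%R%:E <= phi t) /\ (A * s + B = y)%R.
Proof.
move=> ys; have [e e0 ephi] := phi_ball ys; have [K K0 Kphi] := phi_growth.
(* [M] bounds the steepness of descent from [(s, y)]: closer than [e], lower semicontinuity keeps
   [phi] above [y]; farther away, the growth bound is recentred at [s] and its constant part
   absorbed through division by [e]. *)
pose M : R := ((`|y| + 1 + K * `|s - 1|) / e + K)%R.
have bound t : phi t < +oo -> (- M * `|t - s| <= fine (phi t) - y)%R.
  move=> toy; have M0 : (0 <= M)%R.
    by rewrite addr_ge0// divr_ge0 ?(ltW e0)// !addr_ge0// mulr_ge0.
  have [te|te] := ltP `|t - s|%R e.
    have := ephi _ te; rewrite (phi_fin toy) lte_fin => yt.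
    have : (0 <= M * `|t - s|)%R by exact: mulr_ge0.
    by lra.
  have := Kphi t; rewrite {1}(phi_fin toy) lee_fin => Kt.
  have t1 : (K * `|t - 1| <= K * `|t - s| + K * `|s - 1|)%R.
    rewrite -mulrDr ler_wpM2l// (_ : t - 1 = (t - s) + (s - 1))%R ?ler_normD//.
    by ring.
  have yy := ler_norm y.
  have : (`|y| + 1 + K * `|s - 1| <=
      (`|y| + 1 + K * `|s - 1|) / e * `|t - s|)%R.
    rewrite -mulrA ler_peMr//; first by rewrite !addr_ge0// mulr_ge0.
    by rewrite ler_pdivlMl// mulr1.
  rewrite /M; lra.
have cross t u : (t < s)%R -> (s < u)%R -> phi t < +oo -> phi u < +oo ->
    ((y - fine (phi t)) / (s - t) <= (fine (phi u) - y) / (u - s))%R.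
  move=> ts su toy uoy.
  have st0 : (0 < s - t)%R by lra.
  have us0 : (0 < u - s)%R by lra.
  have ut0 : (0 < u - t)%R by lra.
  pose k : R := ((s - t) / (u - t))%R.
  have k01 : (0 < k < 1)%R.
    by rewrite divr_gt0//= ltr_pdivrMr// mul1r; lra.
  have := phi_conv k01 toy uoy.
  rewrite (_ : (1 - k) * t + k * u = s)%R; last first.
    by rewrite /k; field; rewrite gt_eqF.
  move=> /(lt_le_trans ys); rewrite lte_fin => h.
  have ke : (k * (u - t) = s - t)%R by rewrite /k; field; rewrite gt_eqF.
  have ke' : ((1 - k) * (u - t) = u - s)%R by rewrite mulrBl ke mul1r; lra.
  rewrite ler_pdivrMr// mulrAC ler_pdivlMr//.
  have : (y * (u - t) <= ((1 - k) * fine (phi t) + k * fine (phi u)) * (u - t))%R.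
    by rewrite ler_pM2r// ltW.
  rewrite mulrDl -!mulrA ![(fine _ * (u - t))%R]mulrC !mulrA ke ke'.
  lra.
(* The element [- M] keeps the set nonempty when [phi] is infinite everywhere left of [s]. *)
pose E : set R := [set a | a = (- M)%R \/
  exists t, [/\ (t < s)%R, phi t < +oo & a = ((y - fine (phi t)) / (s - t))%R]].
have EM : E (- M)%R by left.
have Eub u : (s < u)%R -> phi u < +oo -> ubound E ((fine (phi u) - y) / (u - s))%R.
  move=> su uoy a [->|[t [ts toy ->]]]; last exact: cross.
  have us0 : (0 < u - s)%R by lra.
  by rewrite ler_pdivlMr// -(gtr0_norm us0) bound.
have hsE : has_sup E.
  split; first by exists (- M)%R.
  exists (Order.max M (- M)%R) => a [->|[t [ts toy ->]]].
    by rewrite le_max lexx orbT.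
  have st0 : (0 < s - t)%R by lra.
  rewrite le_max ler_pdivrMr// -[X in (M * X)%R](gtr0_norm st0) distrC.
  by have := bound _ toy; lra.
exists (sup E), (y - sup E * s)%R; split; last by ring.
move=> t; have [toy|] := ltP (phi t) +oo; last first.
  by rewrite leye_eq => /eqP ->; rewrite leey.
have [ts|st|->] := ltgtP t s.
- have : ((y - fine (phi t)) / (s - t) <= sup E)%R.
    by apply: ub_le_sup; [case: hsE|right; exists t].
  have st0 : (0 < s - t)%R by lra.
  by rewrite ler_pdivrMr// (phi_fin toy) lee_fin; lra.
- have : (sup E <= (fine (phi t) - y) / (t - s))%R.
    by apply: ge_sup; [exists (- M)%R|exact: Eub].
  have ts0 : (0 < t - s)%R by lra.
  by rewrite ler_pdivlMr// (phi_fin toy) lee_fin; lra.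
- by apply: le_trans (ltW ys); rewrite lee_fin; lra.
Qed.

(** Dividing an affine minorant [A * t + B] by [t >= 1] leaves at least [A - |B|]. If the limit
    fails to exist, [lim] returns a default value other than [-oo]. *)
Lemma phi_slope_inf_gtNy : phi_slope_inf phi != -oo.
Proof.
have [|A [B [AB _]]] := @entropy_affine_minorant 1%R (-1)%R.
  by rewrite phi1 lte_fin; lra.
rewrite /phi_slope_inf; have [cv|dv] :=
    pselect (cvg ((fun t : R => phi t * (t^-1)%:E) @ +oo%R)); last first.
  by rewrite (dvgP dv).
rewrite -ltNye; apply: (@lt_le_trans _ _ (A - `|B|)%R%:E); first exact: ltNyr.
apply: lime_ge => //; near=> t.
have t1 : (1 <= t)%R by near: t; apply: nbhs_pinfty_ge; rewrite num_real.
have t0 : (0 < t)%R by lra.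
have : (A * t + B)%:E * (t^-1)%:E <= phi t * (t^-1)%:E.
  by rewrite lee_wpmul2r// lee_fin invr_ge0 ltW.
apply: le_trans; rewrite -EFinM lee_fin ler_pdivlMr//.
rewrite mulrBl lerD2l -mulNr.
have := ler_norm (- B)%R; rewrite normrN => h.
have : (`|B| <= `|B| * t)%R by rewrite ler_peMr.
lra.
Unshelve. all: by end_near. Qed.

End entropy.

(** * Finitely supported measures and their expectations *)

Section discrete.
Local Open Scope ereal_scope.
Context (R : realType) d (T : measurableType d).
Hypothesis measurable_set1 : forall x : T, measurable [set x].

Lemma finite_set_measurable (X : set T) : finite_set X -> measurable X.
Proof.
move=> finX; rewrite -(image_id X) -bigcup_imset1.
by apply: fin_bigcup_measurable.
Qed.

Lemma measurable_fun_finite_off d' (U : measurableType d') (X : set T)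
    (f : T -> U) (c : U) :
  finite_set X -> (forall z, ~ X z -> f z = c) -> measurable_fun setT f.
Proof.
move=> finX fc _ B mB; rewrite setTI -(setUIDK (f @^-1` B) X).
apply: measurableU.
  by apply: finite_set_measurable; exact: finite_setIr.
have [Bc|Bc] := pselect (B c).
  rewrite (_ : _ `\` _ = ~` X); last first.
    by apply/seteqP; split => [z []//|z Xz]; split => //=; rewrite fc.
  by apply: measurableC; exact: finite_set_measurable.
by rewrite (_ : _ `\` _ = set0)// -subset0 => z [/= + /fc fz]; rewrite fz.
Qed.

Context (I : eqType) (x : I -> T) (w : I -> R).
Hypothesis w_ge0 : forall i, (0 <= w i)%R.

(** Characterizes the sum of Dirac masses of weight [w i] at [x i], repetitions allowed, by its
    values and its integrals. *)
Definition is_discrete (s : seq I) (m : set T -> \bar R) :=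
  (forall A, m A = (\sum_(i <- s) w i * \1_A (x i))%R%:E) /\
  (forall f : T -> \bar R, measurable_fun setT f -> (forall z, 0 <= f z) ->
    \int[m]_z f z = \sum_(i <- s) (w i)%:E * f (x i)).

Lemma discrete_measure (s : seq I) :
  exists m : {measure set T -> \bar R}, is_discrete s m.
Proof.
elim: s => [|i s [m [mE mint]]].
  exists mzero; split => [A|f mf f0]; first by rewrite big_nil.
  by rewrite integral_measure_zero big_nil.
pose mi := mscale (NngNum (w_ge0 i)) (dirac (x i)).
exists (measure_add mi m); split => [A|f mf f0].
  transitivity (mi A + m A); last by rewrite mE big_cons EFinD EFinM.
  exact: measure_addE.
rewrite ge0_integral_measure_add// ge0_integral_mscale// integral_dirac//.
by rewrite diracT mul1e mint// big_cons.
Qed.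

Lemma discrete_probability (s : seq I) : (\sum_(i <- s) w i = 1)%R ->
  exists P : probability T R, is_discrete s P.
Proof.
move=> w1; have [m [mE mint]] := discrete_measure s.
have m1 : m setT = 1.
  by rewrite mE -w1; under eq_bigr do rewrite indicT mulr1.
have nE : mnormalize m (dirac point) = m :> (set T -> \bar R).
  by apply/funext => A; rewrite /mnormalize m1 onee_eq0/= invr1 mule1.
by exists (mnormalize m (dirac point)); rewrite /is_discrete/= nE.
Qed.

(** Excluding [-oo] at the atoms makes the sum of negative parts finite, so it can be subtracted
    inside the sum even when some value is [+oo]. *)
Lemma Eext_discrete (s : seq I) (m : {measure set T -> \bar R})
    (f : T -> \bar R) : is_discrete s m ->
    (forall i, i \in s -> f (x i) != -oo) ->
  Eext m f = \sum_(i <- s) (w i)%:E * f (x i).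
Proof.
move=> [mE mint] fNy.
pose X := x @` [set` s].
have finX : finite_set X by exact: finite_image.
have mX : measurable X by exact: finite_set_measurable.
have xX i : i \in s -> X (x i) by move=> si; exists i.
(* Zeroing [f] off the finite support changes it only on a null set and makes it measurable. *)
pose f' z := if z \in X then f z else 0.
have mf' : measurable_fun setT f'.
  apply: (measurable_fun_finite_off (c := 0) finX) => z Xz.
  by rewrite /f' memNset.
rewrite (@eq_Eext_off _ _ _ m (~` X) f f') //; last 3 first.
- exact: measurableC.
- rewrite mE big_seq big1// => i si.
  by rewrite indicE memNset ?mulr0//= => /(_ (xX _ si)).
- by move=> z /contrapT Xz; rewrite /f' mem_set.
have f'x i : i \in s -> f' (x i) = f (x i).
  by move=> si; rewrite /f' mem_set//; exact: xX.
rewrite /Eext !mint//; [|exact: measurable_funeneg|exact: measurable_funepos].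
have -> : \sum_(i <- s) (w i)%:E * f'^\- (x i)
    = (\sum_(i <- s) w i * fine (f'^\- (x i)))%R%:E.
  rewrite -sumEFin big_seq [RHS]big_seq; apply: eq_bigr => i si.
  rewrite EFinM fineK// funenegE f'x//.
  have := fNy _ si; case: (f (x i)) => [r| |] // _.
    by rewrite /maxe; case: ifPn.
  by rewrite (max_idPr (leNye _)).
have -> : \sum_(i <- s) (w i)%:E * f (x i) =
    \sum_(i <- s) (w i)%:E * f'^\+ (x i)
    - (\sum_(i <- s) w i * fine (f'^\- (x i)))%R%:E.
  rewrite -EFinN -sumrN -sumEFin -big_split/= big_seq [RHS]big_seq.
  apply: eq_bigr => i si.
  rewrite funeposE funenegE f'x//.
  have := fNy _ si; have := w_ge0 i; case: (f (x i)) => [r| |] //= wi _.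
    rewrite -!EFin_max/= -EFinM -EFinD; congr EFin.
    have [r0|/ltW r0] := leP 0%R r.
      by rewrite max_r ?oppr_le0//; ring.
    by rewrite max_l ?oppr_ge0//; ring.
  have -> : maxe +oo 0 = +oo :> \bar R by exact/max_idPl/leey.
  have -> : maxe (-oo) 0 = 0 :> \bar R by exact/max_idPr/leNye.
  by rewrite /= mulr0 oppr0 adde0.
by case: ifPn => // /eqP ->; rewrite addye.
Qed.

Lemma integral_discrete_in (s : seq I) (m : {measure set T -> \bar R})
    (A : set T) (f : T -> R) : is_discrete s m -> measurable A ->
    measurable_fun setT f -> (forall z, (0 <= f z)%R) ->
  \int[m]_(z in A) (f z)%:E = (\sum_(i <- s) w i * (f (x i) * \1_A (x i)))%R%:E.
Proof.
move=> [_ mint] mA mf f0; rewrite integral_mkcond epatch_indic mint.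
- by rewrite -sumEFin; apply: eq_bigr => i _; rewrite /= !EFinM.
- apply: emeasurable_funM; first exact/measurable_EFinP.
  exact/measurable_EFinP/measurable_indic.
- by move=> z; rewrite /= mule_ge0// lee_fin.
Qed.

End discrete.

(** * Measurability of points and compact sets *)

Lemma measurable_set1X (d1 d2 : measure_display) (T1 : measurableType d1)
    (T2 : measurableType d2) :
    (forall x : T1, measurable [set x]) -> (forall x : T2, measurable [set x]) ->
  forall x : T1 * T2, measurable [set x].
Proof.
move=> m1 m2 [x1 x2]; rewrite (_ : [set _] = [set x1] `*` [set x2]).
  exact: measurableX.
by apply/seteqP; split => [[a b] /= [-> ->]|[a b] /= [/= -> ->]].
Qed.

Section euclidean.
Context (R : realType) (d : nat).

Lemma Rd_closed_measurable (Z : set 'rV[R]_d) :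
  closed Z -> measurable (Z : set (Rd R d)).
Proof.
move=> cZ; rewrite -(setCK Z); apply: measurableC.
by apply: sub_sigma_algebra; exact: closed_openC.
Qed.

Lemma Rd_compact_measurable (Z : set 'rV[R]_d) :
  compact Z -> measurable (Z : set (Rd R d)).
Proof.
move=> cZ; apply: Rd_closed_measurable.
by apply: compact_closed => //; exact: (@norm_hausdorff R 'rV[R]_d).
Qed.

Lemma Rd_measurable_set1 (z : Rd R d) : measurable [set z].
Proof.
apply: (@Rd_closed_measurable [set z]); apply: accessible_closed_set1.
by apply: hausdorff_accessible; exact: (@norm_hausdorff R 'rV[R]_d).
Qed.

End euclidean.

(** * Integrals localized on finitely many atoms *)

Section atoms.
Local Open Scope ereal_scope.
Context (R : realType) d (T : measurableType d) (I : finType) (x : I -> T).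
Hypothesis measurable_set1 : forall z : T, measurable [set z].

(* The points [x i] need not be distinct: an atom that occurs several times is
   weighted by the inverse of its multiplicity. *)
Definition mult (z : T) : R := \sum_(i : I) \1_[set x i] z.

Lemma mult_gt0 i : (0 < mult (x i))%R.
Proof.
rewrite /mult (bigD1 i)//= indicE mem_set// ltr_pwDl//.
by apply: sumr_ge0 => j _.
Qed.

Definition on_atoms (F : T -> R) (z : T) : R :=
  if z \in range x then F z else 0%R.

(** At an atom the indicators of its copies add up to [mult], which cancels the division; elsewhere
    they all vanish. *)
Lemma on_atomsE (F : T -> R) z : on_atoms F z =
  (\sum_(i : I) F (x i) / mult (x i) * \1_[set x i] z)%R.
Proof.
rewrite /on_atoms; have [/set_mem[i _ <-]|xz] := boolP (z \in range x).
  rewrite (eq_bigr (fun j => F (x i) / mult (x i) * \1_[set x j] (x i)))%R.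
    by rewrite -mulr_sumr divfK// gt_eqF// mult_gt0.
  move=> j _; rewrite indicE; have [/set_mem/= ->//|_] := boolP (_ \in _).
  by rewrite !mulr0.
rewrite big1// => i _; rewrite indicE memNset ?mulr0//= => zi.
by move/negP: xz; apply; apply/mem_set; exists i.
Qed.

Context d' (U : measurableType d') (mu : {measure set U -> \bar R}).
Context (V : U -> T) (f : U -> R).
Hypothesis mV : measurable_fun setT V.
Hypothesis intf : mu.-integrable setT (EFin \o f).

Let mV1 z : measurable (V @^-1` [set z]).
Proof. by rewrite -[_ @^-1` _]setTI; exact: mV. Qed.

Lemma integrable_indicM (A : set U) : measurable A ->
  mu.-integrable setT (fun u => (\1_A u * f u)%:E).
Proof.
move=> mA; have := integrableS measurableT mA (@subsetT _ _) intf.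
move/(integrable_mkcond _ mA) => h; apply: eq_integrable h => // u _.
by rewrite epatch_indic/= muleC -EFinM.
Qed.

Lemma integral_indicM (A : set U) :
  \int[mu]_u (\1_A u * f u)%:E = \int[mu]_(u in A) (f u)%:E.
Proof.
rewrite [RHS]integral_mkcond epatch_indic; apply: eq_integral => u _.
by rewrite /= EFinM muleC.
Qed.

Let atom_term (F : T -> R) i u : (F (x i) / mult (x i))%:E *
    (\1_(V @^-1` [set x i]) u * f u)%:E =
  (F (x i) / mult (x i) * \1_[set x i] (V u) * f u)%:E.
Proof. by rewrite -EFinM mulrA. Qed.

Let on_atomsM (F : T -> R) u : (on_atoms F (V u) * f u)%:E =
  \sum_(i <- index_enum I) (F (x i) / mult (x i))%:E *
    (\1_(V @^-1` [set x i]) u * f u)%:E.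
Proof.
rewrite on_atomsE mulr_suml -sumEFin.
by apply: eq_bigr => i _; rewrite atom_term.
Qed.

Lemma integrable_on_atoms (F : T -> R) :
  mu.-integrable setT (fun u => (on_atoms F (V u) * f u)%:E).
Proof.
under eq_fun do rewrite on_atomsM.
apply: integrable_sum => // i _; apply: integrableZl => //.
exact: integrable_indicM.
Qed.

(** The integral sees only the mass of [f] on each fibre of [V]. Both problems use this averaging,
    with [V] the identity or the first projection. *)
Lemma integral_on_atoms (F : T -> R) :
  \int[mu]_u (on_atoms F (V u) * f u)%:E = (\sum_(i : I)
    F (x i) / mult (x i) * fine (\int[mu]_(u in V @^-1` [set x i]) (f u)%:E))%:E.
Proof.
under eq_integral do rewrite on_atomsM.
rewrite integral_sum//; last first.
  by move=> i; apply: integrableZl => //; exact: integrable_indicM.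
rewrite -sumEFin; apply: eq_bigr => i _; rewrite integralZl//; last first.
  exact: integrable_indicM.
rewrite integral_indicM [RHS]EFinM fineK//.
by apply: integrable_fin_num => //; exact: integrableS intf.
Qed.

End atoms.

(** * The finite problem of choosing a density on the atoms *)

Section problem.
Context (R : realType) (d n : nat).
Variables (Z : set 'rV[R]_d) (l : 'rV[R]_d -> R) (phi : R -> \bar R).
Variables (r eps : R) (zh : 'I_n -> 'rV[R]_d) (zn1 : 'rV[R]_d).
Hypotheses (n_gt0 : (0 < n)%N) (Zcompact : compact Z).
Hypotheses (phi_entropy : entropy_fun phi) (eps01 : 0 < eps < 1).
Hypotheses (Zzh : forall i, Z (zh i)) (Zzn1 : Z zn1).
Hypothesis (zn1_max : forall z, Z z -> l z <= l zn1).
Hypothesis (zn1_new : forall i, zn1 != zh i).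

(** The normalization and the budget involve [p] only at the [zh i] and [zn1]. As a function of the
    point rather than of the index, it gives repeated points the same density. *)
Definition feasible (p : Rd R d -> R) : Prop :=
  [/\ forall z, 0 <= p z,
      \sum_(i < n) n%:R^-1 * p (zh i) + p zn1 = 1 &
      (\sum_(i < n) (n%:R^-1)%:E * phi (p (zh i))
         + phi_slope_inf phi * (p zn1)%:E <= r%:E)%E].

Definition payoff (p : Rd R d -> R) : R :=
  \sum_(i < n) n%:R^-1 * (l (zh i) * p (zh i)) + l zn1 * p zn1.

Let idx : seq (option 'I_n) := None :: [seq Some i | i <- enum 'I_n].
Let X (o : option 'I_n) : Rd R d := if o is Some i then zh i else zn1.
Let base (o : option 'I_n) : R := if o is Some i then n%:R^-1 else 1.

Let sum_idx (V : nmodType) (F : option 'I_n -> V) :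
  \sum_(o <- idx) F o = \sum_(i < n) F (Some i) + F None.
Proof. by rewrite big_cons big_map big_enum addrC. Qed.

Let base_ge0 o : 0 <= base o. Proof. by case: o => //= i; rewrite invr_ge0. Qed.
Let eps_gt0 : 0 < eps. Proof. by case/andP: eps01. Qed.
Let Neps_gt0 : 0 < 1 - eps. Proof. by case/andP: eps01; rewrite subr_gt0. Qed.
Let n_neq0 : n%:R != 0 :> R. Proof. by rewrite pnatr_eq0 -lt0n. Qed.

Let phi_gtNy t : phi t != -oo%E.
Proof. by case: phi_entropy => _ [_ [_ []]]. Qed.

Let slopeM_gtNy (a : R) : 0 <= a -> (phi_slope_inf phi * a%:E)%E != -oo%E.
Proof.
move=> a0; have := phi_slope_inf_gtNy phi_entropy.
case: (phi_slope_inf phi) => [s| |]// _.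
move: a0; rewrite le_eqVlt => /predU1P[<-|a0]; first by rewrite mule0.
by rewrite gt0_mulye// lte_fin.
Qed.

Let phiM_gtNy (a t : R) : 0 <= a -> (a%:E * phi t)%E != -oo%E.
Proof.
move=> a0; have := phi_gtNy t; case: (phi t) => [s| |]// _.
move: a0; rewrite le_eqVlt => /predU1P[<-|a0]; first by rewrite mul0e.
by rewrite gt0_muley// lte_fin.
Qed.

(** * From a feasible density to competitors in both problems *)

Lemma feasible_divergence (p : Rd R d -> R) : feasible p ->
  exists mu : probability (Rd R d) R,
    [/\ mu (~` (Z : set (Rd R d))) = 0%E,
        (phi_div phi mu (muhat zh) <= r%:E)%E
      & (payoff p)%:E = Eext mu (fun z => (l z)%:E)].
Proof.
move=> [p0 p1 pr].
have w0 o : 0 <= base o * p (X o) by rewrite mulr_ge0.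
have w1 : \sum_(o <- idx) base o * p (X o) = 1 by rewrite sum_idx/= mul1r.
have [mu muD] := discrete_probability X w0 w1.
have [rho rhoD] := discrete_measure X base_ge0 idx.
have finX : finite_set (X @` [set` idx]) by exact: finite_image.
have Xidx o : (X @` [set` idx]) (X o).
  exists o => //=; case: o => [i|]; rewrite /idx inE//=.
  by rewrite mem_map ?mem_enum// => ? ? [].
(* One representation suffices, [phi_div] being an infimum: relative to [rho], [mu] has density [p],
   and [muhat zh] has density 1 at the [zh i] and 0 at the new point [zn1]. Cutting off outside the
   atoms gives measurability. *)
pose p' z := if z \in X @` [set` idx] then p z else 0.
pose q' (z : Rd R d) : R := if z \in zh @` setT then 1 else 0.
have mp' : measurable_fun setT p'.
  apply: (@measurable_fun_finite_off _ _ (@Rd_measurable_set1 R d)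
    _ _ _ p' 0 finX) => z Xz.
  by rewrite /p' memNset.
have mq' : measurable_fun setT q'.
  have finS : finite_set (zh @` setT : set (Rd R d)) by exact: finite_image.
  apply: (@measurable_fun_finite_off _ _ (@Rd_measurable_set1 R d)
    _ _ _ q' 0 finS) => z Xz.
  by rewrite /q' memNset.
have p'0 z : 0 <= p' z by rewrite /p'; case: ifPn.
have q'0 z : 0 <= q' z by rewrite /q'; case: ifPn.
have p'X o : p' (X o) = p (X o) by rewrite /p' mem_set.
have q'zh i : q' (zh i) = 1 by rewrite /q' mem_set//; exists i.
have q'zn1 : q' zn1 = 0.
  by rewrite /q' memNset// => -[i _ /eqP]; rewrite eq_sym (negbTE (zn1_new i)).
have [muE _] := muD.
exists mu; split.
- rewrite muE big1// => o _; rewrite indicE memNset ?mulr0//=.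
  by apply; case: o.
- apply: le_trans pr; apply: ereal_inf_lbound; exists rho, p', q'; split => //; split.
  + move=> A mA; rewrite (integral_discrete_in rhoD)// muE; congr EFin.
    by apply: eq_bigr => o _; rewrite p'X mulrA.
  + move=> A mA; rewrite (integral_discrete_in rhoD)// sum_idx/= q'zn1 mul0r mulr0.
    rewrite addr0 /muhat mulr_sumr; congr EFin.
    by apply: eq_bigr => i _; rewrite q'zh mul1r.
  + have int_zh i : div_integrand phi (p' (zh i)) (q' (zh i)) = phi (p (zh i)).
      by rewrite /div_integrand q'zh ltr01 mul1e divr1 (p'X (Some i)).
    have int_zn1 : div_integrand phi (p' zn1) (q' zn1)
        = (phi_slope_inf phi * (p zn1)%:E)%E.
      rewrite /div_integrand q'zn1 ltxx (p'X None); case: ltP => [_|h].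
        by rewrite muleC.
      have -> : p (X None) = 0 by apply/le_anti; rewrite h p0.
      by rewrite mule0.
    rewrite (Eext_discrete (@Rd_measurable_set1 R d) base_ge0 rhoD).
      rewrite sum_idx/= int_zn1 mul1e; congr (_ + _)%E.
      by apply: eq_bigr => i _; rewrite int_zh.
    by case=> [i|] _ /=; rewrite ?int_zh// int_zn1 slopeM_gtNy.
- rewrite (Eext_discrete (@Rd_measurable_set1 R d) w0 muD)//.
  under eq_bigr do rewrite -EFinM.
  rewrite sumEFin sum_idx /payoff/= mul1r [p zn1 * _]mulrC; congr (_ + _)%:E.
  by apply: eq_bigr => i _; ring.
Qed.

Lemma feasible_transport (p : Rd R d -> R) : feasible p ->
  exists nu : probability (Rd R d * R)%type R,
    [/\ nu (~` ((Z : set (Rd R d)) `*` [set w : R | 0 <= w])) = 0%E,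
        (OT_moment (cost phi eps zh zn1) nu (nuhat eps zh zn1) <= r%:E)%E
      & (payoff p)%:E = Eext nu (fun x => (l x.1 * x.2)%:E)].
Proof.
move=> [p0 p1 pr].
pose k (o : option 'I_n) : R := if o is Some i then (1 - eps) / n%:R else eps.
(* Chosen so that [k o * W o] is [base o * p (X o)]: the moment constraint becomes the normalization
   of [p], and the factors in [eps] cancel in the cost. *)
pose W (o : option 'I_n) : R :=
  if o is Some i then p (zh i) / (1 - eps) else p zn1 / eps.
pose Wh (o : option 'I_n) : R := if o is Some i then (1 - eps)^-1 else 0.
have k0 o : 0 <= k o.
  by case: o => [i|] /=; [rewrite divr_ge0// ltW|exact: ltW].
have W0 o : 0 <= W o by case: o => [i|] /=; rewrite divr_ge0// ltW.
have k1 : \sum_(o <- idx) k o = 1.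
  rewrite sum_idx/= sumr_const card_ord -[(_ / _) *+ _]mulr_natr divfK//; ring.
have kW1 : \sum_(o <- idx) k o * W o = 1.
  rewrite sum_idx/= -[RHS]p1; congr (_ + _).
    by apply: eq_bigr => i _; field; rewrite n_neq0 gt_eqF.
  by field; rewrite gt_eqF.
have mset1 := measurable_set1X (@Rd_measurable_set1 R d) (@measurable_set1 R).
have mset2 := measurable_set1X mset1 mset1.
have [nu nuD] := discrete_probability (fun o => (X o, W o)) k0 k1.
have [pi piD] := discrete_probability (fun o => ((X o, W o), (X o, Wh o))) k0 k1.
have [nuE _] := nuD; have [piE _] := piD.
exists nu; split.
- rewrite nuE big1// => o _; rewrite indicE memNset ?mulr0//=.
  by apply; split => /=; [case: o|exact: W0].
- apply: le_trans pr; apply: ereal_inf_lbound; exists pi; split.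
  + by move=> A mA; rewrite nuE piE.
  + move=> A mA; rewrite piE /nuhat sum_idx/= mulr_sumr; congr EFin.
  + rewrite (Eext_discrete mset2 k0 piD)//=.
    by under eq_bigr do rewrite -EFinM; rewrite sumEFin kW1.
  + have cost_zh i : cost phi eps zh zn1
        ((X (Some i), W (Some i)), (X (Some i), Wh (Some i)))
        = (((1 - eps)^-1)%:E * phi (p (zh i)))%E.
      rewrite /cost/= eqxx/= ifT; last by apply/existsP; exists i.
      by rewrite mulrC divfK// gt_eqF.
    have cost_zn1 : cost phi eps zh zn1
        ((X None, W None), (X None, Wh None))
        = (phi_slope_inf phi * (p zn1 / eps)%:E)%E.
      rewrite /cost/= eqxx/= ifF ?eqxx//.
      by apply/negbTE/existsPn => i; exact: zn1_new.
    rewrite (Eext_discrete mset2 k0 piD).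
      rewrite sum_idx cost_zn1/=; congr (_ + _)%E.
        apply: eq_bigr => i _; rewrite cost_zh muleA -EFinM; congr (_%:E * _)%E.
        by field; rewrite n_neq0 gt_eqF.
      rewrite muleCA -EFinM; congr (_ * _%:E)%E.
      by rewrite mulrC divfK// gt_eqF.
    move=> [i|] _; first by rewrite cost_zh phiM_gtNy// invr_ge0 ltW.
    by rewrite cost_zn1 slopeM_gtNy// divr_ge0// ltW.
- rewrite (Eext_discrete mset1 k0 nuD)//=.
  under eq_bigr do rewrite -EFinM.
  rewrite sumEFin sum_idx /payoff/=; congr (_ + _)%:E.
    by apply: eq_bigr => i _; field; rewrite n_neq0 gt_eqF.
  by field; rewrite gt_eqF.
Qed.

(** Real lower bounds approach finite values of [phi] and of the slope, and grow without limit at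
    infinite ones. The uniform bound [r] thus excludes infinite terms, except an infinite slope
    multiplied by [p zn1 = 0], and passes to the limit in the rest. *)
Lemma feasible_by_minorants (p : Rd R d -> R) :
    (forall z, 0 <= p z) -> \sum_(i < n) n%:R^-1 * p (zh i) + p zn1 = 1 ->
    (forall (y : Rd R d -> R) (c : R),
      (forall i, (y (zh i))%:E < phi (p (zh i)))%E ->
      (c%:E <= phi_slope_inf phi)%E ->
      \sum_(i < n) n%:R^-1 * y (zh i) + c * p zn1 <= r) ->
  feasible p.
Proof.
move=> p0 p1 minor; split => //.
have n0 : 0 < n%:R^-1 :> R by rewrite invr_gt0 ltr0n.
have slNy := phi_slope_inf_gtNy phi_entropy.
pose y (K : R) (z : Rd R d) : R :=
  if phi (p z) == +oo%E then K else fine (phi (p z)) - K^-1.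
pose c (K : R) : R :=
  if phi_slope_inf phi == +oo%E then K else fine (phi_slope_inf phi).
have yK K : 0 < K -> \sum_(i < n) n%:R^-1 * y K (zh i) + c K * p zn1 <= r.
  move=> K0; apply: minor => [i|].
    rewrite /y; case: ifPn => [/eqP ->|poo]; first exact: ltry.
    rewrite -[ltRHS]fineK ?fin_numE ?phi_gtNy// lte_fin.
    by rewrite ltrBlDr ltrDl invr_gt0.
  rewrite /c; case: ifPn => [/eqP ->|soo]; first exact: leey.
  by rewrite fineK// fin_numE slNy.
(* [- C] bounds from below, for all [K >= 1], the terms other than the one assumed infinite; the
   summand 1 covers [K^-1]. *)
pose C : R := \sum_(i < n) n%:R^-1 * (`|fine (phi (p (zh i)))| + 1)
  + `|fine (phi_slope_inf phi)| * p zn1.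
have y_lb K z : 1 <= K -> - (`|fine (phi (p z))| + 1) <= y K z.
  move=> K1; rewrite /y; case: ifPn => _.
    by have := normr_ge0 (fine (phi (p z))); lra.
  have : K^-1 <= 1 by rewrite invf_le1//; lra.
  by have := ler_norm (- fine (phi (p z))); rewrite normrN; lra.
have c_lb K : 1 <= K -> - `|fine (phi_slope_inf phi)| <= c K.
  move=> K1; rewrite /c; case: ifPn => _.
    by have := normr_ge0 (fine (phi_slope_inf phi)); lra.
  by have := ler_norm (- fine (phi_slope_inf phi)); rewrite normrN; lra.
have big_contra (a : R) : 0 < a -> (forall K, 1 <= K -> a * K - C <= r) -> False.
  move=> a0 h; pose K := Num.max 1 ((r + C + 1) / a).
  have := h K; rewrite le_max lexx => /(_ isT).
  have : a * ((r + C + 1) / a) <= a * K by rewrite ler_pM2l// le_max lexx orbT.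
  by rewrite mulrC divfK ?gt_eqF//; lra.
have yfin i : phi (p (zh i)) \is a fin_num.
  rewrite fin_numE phi_gtNy/=; apply/negP => /eqP ioo.
  apply: (big_contra _ n0) => K K1.
  apply: le_trans (yK K _); last by lra.
  rewrite /C (bigD1 i)//= [X in _ <= X + _](bigD1 i)//=.
  have -> : y K (zh i) = K by rewrite /y ioo eqxx.
  have : \sum_(j < n | j != i) - (n%:R^-1 * (`|fine (phi (p (zh j)))| + 1))
      <= \sum_(j < n | j != i) n%:R^-1 * y K (zh j).
    by apply: ler_sum => j _; rewrite -mulrN ler_wpM2l ?(ltW n0)// y_lb.
  rewrite sumrN; have : - `|fine (phi_slope_inf phi)| * p zn1 <= c K * p zn1.
    by rewrite ler_wpM2r// c_lb.
  have : 0 <= n%:R^-1 * (`|fine (phi (p (zh i)))| + 1).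
    by rewrite mulr_ge0 ?(ltW n0)// addr_ge0.
  by lra.
have slfin : p zn1 = 0 \/ phi_slope_inf phi \is a fin_num.
  have [->|pn0] := eqVneq (p zn1) 0; [by left|right].
  have pgt0 : 0 < p zn1 by rewrite lt_def pn0 p0.
  rewrite fin_numE slNy/=; apply/negP => /eqP soo.
  apply: (big_contra _ pgt0) => K K1.
  apply: le_trans (yK K _); last by lra.
  have -> : c K = K by rewrite /c soo eqxx.
  rewrite /C.
  have : \sum_(j < n) - (n%:R^-1 * (`|fine (phi (p (zh j)))| + 1))
      <= \sum_(j < n) n%:R^-1 * y K (zh j).
    by apply: ler_sum => j _; rewrite -mulrN ler_wpM2l ?(ltW n0)// y_lb.
  rewrite sumrN; have : 0 <= `|fine (phi_slope_inf phi)| * p zn1.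
    by rewrite mulr_ge0.
  by lra.
have -> : (\sum_(i < n) (n%:R^-1)%:E * phi (p (zh i))
      + phi_slope_inf phi * (p zn1)%:E)%E
    = (\sum_(i < n) n%:R^-1 * fine (phi (p (zh i)))
      + fine (phi_slope_inf phi) * p zn1)%:E.
  rewrite EFinD -sumEFin; congr (_ + _)%E.
    by apply: eq_bigr => i _; rewrite EFinM fineK.
  by case: slfin => [->|sfin]; rewrite ?mule0 ?mulr0// EFinM fineK.
(* With [K = e^-1] the total loss is exactly [e], since the weights [n^-1] sum to one. *)
rewrite lee_fin; apply/ler_addgt0Pr => e e0.
have := yK e^-1; rewrite invr_gt0 => /(_ e0).
have -> : c e^-1 * p zn1 = fine (phi_slope_inf phi) * p zn1.
  case: slfin => [->|sfin]; first by rewrite !mulr0.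
  by rewrite /c ifF//; apply/negbTE; move: sfin; rewrite fin_numE => /andP[].
have -> : \sum_(i < n) n%:R^-1 * y e^-1 (zh i) =
    \sum_(i < n) n%:R^-1 * fine (phi (p (zh i))) - e.
  rewrite (eq_bigr (fun i => n%:R^-1 * fine (phi (p (zh i))) - n%:R^-1 * e)).
    rewrite sumrB sumr_const card_ord -[(_ * e) *+ _]mulr_natl mulrA divff//.
    by rewrite mul1r.
  move=> i _; rewrite /y ifF ?invrK ?mulrBr//.
  by apply/negbTE; move: (yfin i); rewrite fin_numE => /andP[].
by lra.
Qed.

(** * From the divergence problem to a feasible density *)

Let mset1 := @Rd_measurable_set1 R d.
Let zhR : 'I_n -> Rd R d := zh.
Let S : set (Rd R d) := range zhR.

Let mS : measurable S.
Proof. by apply: (finite_set_measurable mset1); exact: finite_image. Qed.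

Let multzh_gt0 i : 0 < mult R zhR (zh i). Proof. exact: mult_gt0. Qed.

Let muhat1 i : muhat zh [set zhR i] = (mult R zhR (zh i) / n%:R)%:E.
Proof.
rewrite /muhat mulrC /mult; congr (_ / _)%:E; apply: eq_bigr => j _.
rewrite !indicE; congr ((nat_of_bool _)%:R).
by apply/idP/idP => /set_mem/= e; exact/mem_set/esym.
Qed.

Let muhatCS : muhat zh (~` S) = 0%E.
Proof.
rewrite /muhat big1 ?mulr0// => i _; rewrite indicE memNset//=.
by apply; exists i.
Qed.

Let muhatT : muhat zh setT = 1%E.
Proof.
rewrite /muhat (eq_bigr (fun=> 1)) => [|i _]; last by rewrite indicT.
by rewrite sumr_const card_ord mulVf.
Qed.

Lemma divergence_feasible (mu : probability (Rd R d) R) :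
    mu (~` (Z : set (Rd R d))) = 0%E ->
    (phi_div phi mu (muhat zh) <= r%:E)%E ->
  exists p, feasible p /\ (Eext mu (fun z => (l z)%:E) <= (payoff p)%:E)%E.
Proof.
move=> muZ mur.
have mZ := Rd_compact_measurable Zcompact.
have mufin A : measurable A -> mu A = (fine (mu A))%:E.
  by move=> mA; rewrite fineK// fin_num_measure.
(* All mass off [S] is assigned to [zn1]; at a sample point, [p] is the ratio of the masses of [mu]
   and [muhat zh], the latter being [mult R zhR z / n]. *)
pose p (z : Rd R d) : R := if z == zn1 then fine (mu (~` S))
  else fine (mu [set z]) * n%:R / mult R zhR z.
have p0 z : 0 <= p z.
  rewrite /p; case: ifPn => _; first exact: fine_ge0.
  rewrite divr_ge0 ?mulr_ge0 ?fine_ge0//.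
  by apply: sumr_ge0 => i _.
have pzn1 : p zn1 = fine (mu (~` S)) by rewrite /p eqxx.
have pzh i : p (zh i) = fine (mu [set zhR i]) * n%:R / mult R zhR (zh i).
  by rewrite /p ifF//; apply/negbTE; rewrite eq_sym.
have int1 : mu.-integrable setT (EFin \o cst 1).
  exact: finite_measure_integrable_cst.
have int1A A : measurable A -> (\int[mu]_(u in A) (1 : R)%:E)%E = mu A.
  by move=> mA; have := integral_cst mu mA 1%E; rewrite mul1e.
have int_atoms (F : Rd R d -> R) :
    (\int[mu]_z (on_atoms zhR F z * 1)%:E)%E =
    (\sum_(i < n) n%:R^-1 * (F (zh i) * p (zh i)))%:E.
  rewrite (integral_on_atoms zhR mset1 (@measurable_id _ _ setT) int1)//.
  congr EFin; apply: eq_bigr => i _.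
  rewrite pzh int1A; last exact: mset1.
  field.
  by rewrite n_neq0 gt_eqF.
have intCS : (\int[mu]_z (\1_(~` S) z * 1)%:E)%E = (p zn1)%:E.
  rewrite integral_indicM int1A; last exact: measurableC.
  by rewrite pzn1 -mufin//; exact: measurableC.
exists p; split.
  apply: feasible_by_minorants => //.
    apply: EFin_inj; rewrite -(probability_setT mu).
    rewrite EFinD -intCS.
    rewrite (eq_bigr (fun i => n%:R^-1 * (cst 1 (zhR i) * p (zh i)))); last first.
      by move=> i _; rewrite mul1r.
    rewrite -int_atoms -integralD//; last 2 first.
    - exact: (integrable_on_atoms zhR mset1 (@measurable_id _ _ setT) int1).
    - by apply: integrable_indicM => //; exact: measurableC.
    rewrite -int1A//; apply: eq_integral => z _.
    rewrite -EFinD !mulr1 /on_atoms indicE in_setC.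
    by case: (z \in _); rewrite /= ?addr0 ?add0r.
  move=> y c yphi cs; rewrite -lee_fin; apply: le_trans mur.
  apply: le_ereal_inf_tmp => _ [rho [p' [q' [mp' mq' p'0 q'0 [muE muhatE ->]]]]].
  have intq' : rho.-integrable setT (EFin \o q').
    apply/integrableP; split; first exact/measurable_EFinP.
    under eq_integral do rewrite /= ger0_norm//.
    by rewrite -muhatE// muhatT ltry.
  have intp' : rho.-integrable setT (EFin \o p').
    apply/integrableP; split; first exact/measurable_EFinP.
    under eq_integral do rewrite /= ger0_norm//.
    by rewrite -muE// probability_setT ltry.
  (* [G] bounds the integrand from below almost everywhere, and its integral is the required finite
     sum whatever [rho] is. *)
  pose G z := ((on_atoms zhR y z * q' z)%:E + c%:E * (\1_(~` S) z * p' z)%:E)%E.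
  have intG1 := integrable_on_atoms zhR mset1 (@measurable_id _ _ setT) intq' y.
  have intG2 : rho.-integrable setT (fun z => (\1_(~` S) z * p' z)%:E).
    by apply: integrable_indicM => //; exact: measurableC.
  have intG : rho.-integrable setT G.
    by apply: integrableD => //; exact: integrableZl.
  have -> : (\sum_(i < n) n%:R^-1 * y (zh i) + c * p zn1)%:E = Eext rho G.
    rewrite Eext_integrable// integralD//; last exact: integrableZl.
    rewrite integralZl// integral_indicM -muE; last exact: measurableC.
    rewrite (mufin (~` S)); last exact: measurableC.
    rewrite -pzn1 EFinD EFinM; congr (_ + _)%E.
    rewrite (integral_on_atoms zhR mset1 (@measurable_id _ _ setT) intq')//.
    congr EFin; apply: eq_bigr => i _.
    rewrite preimage_id -muhatE// muhat1/=; field.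
    by rewrite n_neq0 gt_eqF.
  (* [muhat zh] does not charge the complement of [S], so this set is [rho]-null; elsewhere off [S]
     the integrand is the slope times [p']. *)
  pose N : set (Rd R d) := ~` S `&` [set z | q' z != 0].
  have mN : measurable N.
    apply: measurableI; first exact: measurableC.
    rewrite (_ : [set z | q' z != 0] = q' @^-1` (~` [set 0])).
      by rewrite -[_ @^-1` _]setTI; apply: mq' => //; exact: measurableC.
    by apply/seteqP; split => z /= /eqP.
  have rhoN : rho N = 0%E.
    have : (\int[rho]_(z in ~` S) `|(q' z)%:E| = 0)%E.
      under eq_integral do rewrite /= ger0_norm//.
      by rewrite -muhatE//; exact: measurableC.
    have mq'S : measurable_fun (~` S) (EFin \o q').
      by apply/measurable_EFinP; exact: measurable_funTS.
    move/(ae_eq_integral_abs rho (measurableC mS) mq'S) => [N' [mN' N'0 sub]].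
    apply: (subset_measure0 mN mN' _ N'0) => z [Sz /= /eqP qz].
    by apply: sub => /= /(_ Sz) [].
  apply: (le_Eext_off mN rhoN) => z Nz; rewrite /G /on_atoms.
  have [zS|zS] := boolP (z \in range zhR).
    have [i _ zi] := set_mem zS.
    rewrite [\1__ _]indicE in_setC zS mul0r mule0 adde0.
    (* The [rho]-mass of the point cancels in [p' / q']: it is nonzero and finite because [muhat zh]
       gives the point positive finite mass. *)
    have atom (f : Rd R d -> R) :
        (\int[rho]_(u in [set z]) (f u)%:E = (f z)%:E * rho [set z])%E.
      have := integral_cst rho (mset1 z) (f z)%:E; move=> <-.
      by apply: eq_integral => u /set_mem/= ->.
    have qz := muhatE [set z] (mset1 z).
    have pz := muE [set z] (mset1 z).
    rewrite atom -zi muhat1 in qz; rewrite atom (mufin _ (mset1 z)) -zi in pz.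
    have qzi0 : 0 < q' (zhR i).
      rewrite lt_def q'0 andbT; apply/eqP => q0.
      move: qz; rewrite q0 mul0e => -[] /eqP.
      by rewrite mulf_eq0 invr_eq0 (negbTE n_neq0) orbF gt_eqF.
    have rfin : rho [set zhR i] \is a fin_num.
      rewrite ge0_fin_numE// ltNge leye_eq; apply/negP => /eqP roo.
      by move: qz; rewrite roo gt0_muley ?lte_fin.
    move: qz pz; rewrite -(fineK rfin) -!EFinM => -[qz] [pz].
    have a0 : fine (rho [set zhR i]) != 0.
      apply/eqP => a0; move: qz; rewrite a0 mulr0 => /eqP.
      by rewrite mulf_eq0 invr_eq0 (negbTE n_neq0) orbF gt_eqF.
    rewrite -zi /div_integrand qzi0.
    have -> : p' (zhR i) / q' (zhR i) = p (zh i).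
      rewrite pzh pz.
      have -> : mult R zhR (zh i) = q' (zhR i) * fine (rho [set zhR i]) * n%:R.
        by rewrite -qz divfK.
      by field; rewrite a0 n_neq0 gt_eqF.
    by rewrite mulrC EFinM lee_wpmul2l ?lee_fin// ltW// yphi.
  have q0 : q' z = 0.
    apply/eqP; apply: contrapT => /negP qz; apply: Nz; split => //.
    by move=> /mem_set; exact/negP.
  rewrite [\1__ _]indicE in_setC (negbTE zS) mul1r mul0r add0e.
  rewrite /div_integrand q0 ltxx; case: ltP => [pz|pz].
    by rewrite muleC lee_wpmul2l// lee_fin ltW.
  have -> : p' z = 0 by apply/le_anti; rewrite pz p'0.
  by rewrite mule0.
(* Off [S], [l] is replaced by its maximum over [Z]; only here may the objective increase. *)
pose G z := ((on_atoms zhR l z * 1)%:E + (l zn1)%:E * (\1_(~` S) z * 1)%:E)%E.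
have intG1 := integrable_on_atoms zhR mset1 (@measurable_id _ _ setT) int1 l.
have intG2 : mu.-integrable setT (fun z => (\1_(~` S) z * 1)%:E).
  by apply: integrable_indicM => //; exact: measurableC.
have intG : mu.-integrable setT G.
  by apply: integrableD => //; exact: integrableZl.
have -> : (payoff p)%:E = Eext mu G.
  rewrite Eext_integrable// integralD//; last exact: integrableZl.
  by rewrite integralZl// intCS int_atoms -EFinM -EFinD.
apply: (le_Eext_off (measurableC mZ) muZ) => z /contrapT Zz.
rewrite /G /on_atoms indicE in_setC.
case: (z \in _); rewrite /= ?mulr1 ?mul0r ?mulr0 ?mule0 ?adde0 ?mule1 ?add0e//.
by rewrite lee_fin zn1_max.
Qed.

(** * From the transport problem to a feasible density *)

Let sum_option (V : nmodType) (F : option 'I_n -> V) :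
  \sum_o F o = \sum_(i < n) F (Some i) + F None.
Proof.
rewrite -sum_idx; apply: perm_big; apply: uniq_perm.
- exact: index_enum_uniq.
- rewrite /= map_inj_uniq ?enum_uniq ?andbT; last by move=> ? ? [].
  by apply/negP => /mapP[].
move=> [i|]; rewrite mem_index_enum in_cons//=.
by rewrite mem_map ?mem_enum// => ? ? [].
Qed.

Let charged (o : option 'I_n) : R :=
  if o is Some i then (1 - eps) / n%:R else eps.

(** As [zn1] differs from every [zh i], all copies of one point carry the same weight, and the
    multiplicity factors out. *)
Let nuhatX o : nuhat eps zh zn1 ([set X o] `*` setT)
  = (charged o * mult R X (X o))%:E.
Proof.
rewrite /nuhat /mult sum_option; congr EFin.
have ind (a b : Rd R d) (w : R) :
    \1_([set a] `*` [set: R]) (b, w) = \1_[set b] a :> R.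
  rewrite !indicE; congr ((nat_of_bool _)%:R).
  apply/idP/idP => /set_mem/= => [[e _]|e]; apply/mem_set => //=.
rewrite ind (eq_bigr (fun j => \1_[set X (Some j)] (X o))) => [|j _]; last first.
  exact: ind.
case: o => [i|] /=.
  rewrite [\1__ (zh i)]indicE [_ \in [set zn1]](_ : _ = false) ?mulr0 ?addr0//.
  by rewrite memNset//= => e; have := zn1_new i; rewrite e eqxx.
rewrite big1 ?mulr0 ?add0r// => i _; rewrite indicE memNset//= => e.
by have := zn1_new i; rewrite -e eqxx.
Qed.

(** The event that [V] and its counterpart agree at an atom, as a finite union so that measurability
    is immediate. *)
Let on_diagonal : set ((Rd R d * R) * (Rd R d * R)) :=
  \bigcup_o ((fst \o fst) @^-1` [set X o] `&` (fst \o snd) @^-1` [set X o]).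

Let m11 : measurable_fun setT
  (fst \o fst : (Rd R d * R) * (Rd R d * R) -> Rd R d).
Proof. by apply: measurableT_comp. Qed.

Let m21 : measurable_fun setT
  (fst \o snd : (Rd R d * R) * (Rd R d * R) -> Rd R d).
Proof. by apply: measurableT_comp. Qed.

Let measurable_diagonal : measurable on_diagonal.
Proof.
apply: fin_bigcup_measurable => // o _.
by apply: measurableI; rewrite -[_ @^-1` _]setTI; [exact: m11|exact: m21].
Qed.

Let cost_off_diagonal x : ~ on_diagonal x -> cost phi eps zh zn1 x = +oo%E.
Proof.
move=> Nx; rewrite /cost; case: ifPn => [/andP[/eqP e /existsP[i /eqP vi]]|_].
  by exfalso; apply: Nx; exists (Some i) => //; split; rewrite /= -?e.
case: ifPn => [/andP[/eqP e /eqP vn]|//].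
by exfalso; apply: Nx; exists None => //; split; rewrite /= -?e.
Qed.

(** The positive part of the cost dominates [+oo] times the indicator of the complement, which has
    infinite integral unless that complement is null. *)
Let off_diagonal_null (pi : probability ((Rd R d * R) * (Rd R d * R))%type R) :
  (Eext pi (cost phi eps zh zn1) < +oo)%E -> pi (~` on_diagonal) = 0%E.
Proof.
move=> /Eext_lty_integral_pos pos_lty.
have mN := measurableC measurable_diagonal.
apply/eqP; apply: contraTT pos_lty => pi0; rewrite -leNgt.
have <- : (\int[pi]_x ((cst +oo) \_ (~` on_diagonal)) x = +oo)%E.
  rewrite -integral_mkcond integral_cst// gt0_mulye//.
  by rewrite lt_def pi0 measure_ge0.
apply: (@ge0_le_integral_off _ _ _ pi set0) => // x.
  by rewrite patchE; case: ifPn => // _; exact: leey.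
move=> _; rewrite patchE; case: ifPn => [/set_mem Nx|].
  by rewrite funeposE cost_off_diagonal// le_max lexx.
by move=> _; exact: funepos_ge0.
Qed.

Lemma transport_feasible (nu : probability (Rd R d * R)%type R) :
    nu (~` ((Z : set (Rd R d)) `*` [set w : R | 0 <= w])) = 0%E ->
    (OT_moment (cost phi eps zh zn1) nu (nuhat eps zh zn1) <= r%:E)%E ->
  exists p, feasible p /\
    Eext nu (fun x => (l x.1 * x.2)%:E) = (payoff p)%:E.
Proof.
move=> nuZ nur.
have mZ := Rd_compact_measurable Zcompact.
have mZW : measurable ((Z : set (Rd R d)) `*` [set w : R | 0 <= w]).
  apply: measurableX => //.
  by rewrite (_ : [set w | 0 <= w] = `[0, +oo[%classic)//= set_itvcy.
have mV : measurable_fun setT (fst : Rd R d * R -> Rd R d) by [].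
have mfst : measurable_fun setT
  (fst : (Rd R d * R) * (Rd R d * R) -> Rd R d * R) by [].
have mVo (o : option 'I_n) :
    measurable ((fst : Rd R d * R -> Rd R d) @^-1` [set X o]).
  by rewrite -[_ @^-1` _]setTI; exact: mV.
(* The infimum is below [+oo], so some coupling has cost below [+oo]; it identifies the law of [V]
   and the mean of [W] under [nu]. *)
have [|_ [pi0 [pi0nu pi0hat pi01 ->]] pi0fin] := @ereal_inf_lt R
    [set v | exists pi : probability ((Rd R d * R) * (Rd R d * R))%type R,
      [/\ (forall A, measurable A -> pi (fst @^-1` A) = nu A),
        (forall A, measurable A -> pi (snd @^-1` A) = nuhat eps zh zn1 A),
        Eext pi (fun x => (x.1.2)%:E) = 1%E
      & v = Eext pi (cost phi eps zh zn1)]] +oo%E.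
  exact: le_lt_trans nur (ltry _).
have pi0N := off_diagonal_null pi0fin.
have mdiagC := measurableC measurable_diagonal.
have pi0_le (A B : set ((Rd R d * R) * (Rd R d * R))) :
    measurable A -> measurable B -> (A `&` on_diagonal `<=` B) ->
    (pi0 A <= pi0 B)%E.
  move=> mA mB AB; apply: (@le_trans _ _ (pi0 (B `|` ~` on_diagonal))).
    apply: le_measure; rewrite ?inE//; first exact: measurableU.
    move=> x Ax; have [dx|dx] := pselect (on_diagonal x); [left|by right].
    exact: AB.
  apply: le_trans (measureU2 pi0 mB mdiagC) _.
  by rewrite [X in (_ + X)%E]pi0N adde0.
pose offX : set (Rd R d * R) := fst @^-1` (~` range X).
have finX : finite_set (range X) by exact: finite_image.
have moffX : measurable offX.
  rewrite -[offX]setTI; apply: mV => //; apply: measurableC.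
  exact: (finite_set_measurable mset1).
have nu_offX : nu offX = 0%E.
  rewrite -pi0nu//; apply: (subset_measure0 _ mdiagC _ pi0N).
    by rewrite -[_ @^-1` _]setTI; exact: mfst.
  by move=> x Vx [j _ [/= xj _]]; apply: Vx; exists j.
have nuX o : nu (fst @^-1` [set X o]) = (charged o * mult R X (X o))%:E.
  rewrite -nuhatX -pi0nu// -pi0hat; last by apply: measurableX => //; exact: mset1.
  rewrite (_ : snd @^-1` _ = (fst \o snd) @^-1` [set X o]); last first.
    by apply/seteqP; split => [x []|x].
  rewrite (_ : fst @^-1` _ = (fst \o fst) @^-1` [set X o])//.
  have mA : measurable ((fst \o fst : (Rd R d * R) * (Rd R d * R) -> _) @^-1` [set X o]).
    by rewrite -[_ @^-1` _]setTI; exact: m11.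
  have mB : measurable ((fst \o snd : (Rd R d * R) * (Rd R d * R) -> _) @^-1` [set X o]).
    by rewrite -[_ @^-1` _]setTI; exact: m21.
  apply/eqP; rewrite eq_le; apply/andP; split; apply: pi0_le => //.
    by move=> x [/= xo [j _ [/= e1 e2]]]; rewrite e2 -e1.
  by move=> x [/= xo [j _ [/= e1 e2]]]; rewrite e1 -e2.
(* A nonnegative version of [W], equal to it [nu]-almost surely. *)
pose f (x : Rd R d * R) : R := Num.max x.2 0.
have mf : measurable_fun setT f by exact: measurable_maxr.
have f0 x : 0 <= f x by rewrite le_max lexx orbT.
have fE x : ((Z : set (Rd R d)) `*` [set w : R | 0 <= w]) x -> f x = x.2.
  by move=> [_ x0]; exact/max_idPl.
have Ef : Eext nu (EFin \o f) = 1%E.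
  rewrite -pi01 -(@Eext_pushforward _ _ _ nu _ _ pi0 fst (EFin \o snd))//; last first.
    exact/measurable_EFinP.
  apply: (eq_Eext_off (measurableC mZW) nuZ) => x /contrapT Zx.
  by rewrite /= fE.
have intf : nu.-integrable setT (EFin \o f) by exact: Eext_fin_integrable Ef.
have int1 : nu.-integrable setT (EFin \o cst 1).
  exact: finite_measure_integrable_cst.
pose M (z : Rd R d) : R := fine (\int[nu]_(x in fst @^-1` [set z]) (f x)%:E)%E.
(* [p (zh i)] is [1 - eps] times the mean of [W] given [V = zh i]; [p zn1] is [eps] times its mean
   given [V = zn1], where the multiplicity is one. *)
pose p (z : Rd R d) : R :=
  M z / mult R X z * (if z == zn1 then 1 else n%:R).
have p0 z : 0 <= p z.
  rewrite !mulr_ge0 ?invr_ge0//; last by case: ifPn.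
    by rewrite fine_ge0// integral_ge0// => x _; rewrite lee_fin.
  by apply: sumr_ge0.
have baseM o : M (X o) / mult R X (X o) = base o * p (X o).
  rewrite /p; case: o => [i|] /=; last by rewrite eqxx mulr1 mul1r.
  rewrite eq_sym (negbTE (zn1_new i)) mulrCA mulVf// mulr1//.
have int_atoms (F : Rd R d -> R) :
    Eext nu (fun x => (on_atoms X F x.1 * f x)%:E) =
    (\sum_(i < n) n%:R^-1 * (F (zh i) * p (zh i)) + F zn1 * p zn1)%:E.
  rewrite Eext_integrable; last first.
    exact: (integrable_on_atoms X mset1 mV intf).
  rewrite (integral_on_atoms X mset1 mV intf).
  rewrite (eq_bigr (fun o => F (X o) * (base o * p (X o)))) => [|o _]; last first.
    by rewrite -baseM mulrAC mulrA.
  rewrite sum_option/= mul1r; congr (_ + _)%:E.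
  by apply: eq_bigr => i _; rewrite mulrCA.
have nu_bad : nu (offX `|` ~` ((Z : set (Rd R d)) `*` [set w : R | 0 <= w])) = 0%E.
  by apply: null_set_setU => //; exact: measurableC.
have mbad := measurableU _ _ moffX (measurableC mZW).
have onX (F : Rd R d -> R) (x : Rd R d * R) :
    ~ (offX `|` ~` ((Z : set (Rd R d)) `*` [set w : R | 0 <= w])) x ->
    on_atoms X F x.1 * f x = F x.1 * x.2.
  move=> /not_orP[/contrapT Xx /contrapT Zx].
  by rewrite fE// /on_atoms mem_set.
exists p; split; last first.
  rewrite /payoff -int_atoms; apply: (eq_Eext_off mbad nu_bad) => x bx.
  by rewrite onX.
apply: feasible_by_minorants => //.
  apply: EFin_inj; rewrite -[RHS]Ef; have := int_atoms (cst 1).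
  under eq_bigr do rewrite mul1r.
  rewrite mul1r => <-; apply: (eq_Eext_off mbad nu_bad) => x bx.
  rewrite onX// mul1r; congr EFin; rewrite fE//.
  by apply: contrapT => Zx; apply: bx; right.
move=> y c yphi cs; rewrite -lee_fin; apply: le_trans nur.
apply: le_ereal_inf_tmp => _ [pi [pinu pihat pi1 ->]].
have [pifin|] := ltP (Eext pi (cost phi eps zh zn1)) +oo%E; last first.
  by rewrite leye_eq => /eqP ->; exact: leey.
have piN := off_diagonal_null pifin.
(* Keeping the inequality under the existential makes the statement hold at every [z], so that
   [choice] applies. *)
have minorant z : exists AB : R * R, ((y z)%:E < phi (p z))%E ->
    (forall t, ((AB.1 * t + AB.2)%:E <= phi t)%E) /\ AB.1 * p z + AB.2 = y z.
  have [yz|yz] := pselect ((y z)%:E < phi (p z))%E; last by exists (0, 0).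
  by have [A [B [AB1 AB2]]] := entropy_affine_minorant phi_entropy yz; exists (A, B).
have {minorant} [AB ABP] := choice minorant.
(* Rescaling the minorant gives [(1 - eps)^-1 * phi ((1 - eps) * w) >= A * w + B / (1 - eps)]; at
   [zn1] the cost is at least [c * w]. *)
pose a z := if z == zn1 then c else (AB z).1.
pose b z := if z == zn1 then 0 else (AB z).2 / (1 - eps).
have azh i : a (zh i) = (AB (zh i)).1.
  by rewrite /a eq_sym (negbTE (zn1_new i)).
have bzh i : b (zh i) = (AB (zh i)).2 / (1 - eps).
  by rewrite /b eq_sym (negbTE (zn1_new i)).
have azn1 : a zn1 = c by rewrite /a eqxx.
have bzn1 : b zn1 = 0 by rewrite /b eqxx.
(* [H] is affine in [w] on each fibre, so its expectation involves only fibre masses and means, the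
   same for every coupling; bounding the cost by it is Jensen's inequality. *)
pose H (x : Rd R d * R) :=
  ((on_atoms X a x.1 * f x)%:E + (on_atoms X b x.1 * 1)%:E)%E.
have intH1 := integrable_on_atoms X mset1 mV intf a.
have intH2 := integrable_on_atoms X mset1 mV int1 b.
have intH : nu.-integrable setT H by exact: integrableD.
have -> : (\sum_(i < n) n%:R^-1 * y (zh i) + c * p zn1)%:E = Eext nu H.
  rewrite Eext_integrable// integralD// -Eext_integrable// int_atoms.
  rewrite (integral_on_atoms X mset1 mV int1) sum_option -EFinD; congr EFin.
  rewrite [b (X None)]bzn1 !mul0r addr0 azn1 addrAC -big_split/=; congr (_ + _).
  apply: eq_bigr => i _.
  have -> : (\int[nu]_(u in fst @^-1` [set zh i]) (cst 1 u)%:E)%E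
      = nu (fst @^-1` [set X (Some i)]).
    by have := integral_cst nu (mVo (Some i)) 1%E; rewrite mul1e.
  rewrite nuX/= azh bzh -(ABP _ (yphi i)).2; field.
  by rewrite n_neq0 !gt_eqF//; exact: (mult_gt0 R X (Some i)).
rewrite (Eext_pushforward mfst (measurable_int _ intH) pinu).
pose N := ~` on_diagonal `|`
  fst @^-1` (~` ((Z : set (Rd R d)) `*` [set w : R | 0 <= w])).
have mN2 : measurable ((fst : (Rd R d * R) * (Rd R d * R) -> _) @^-1`
    (~` ((Z : set (Rd R d)) `*` [set w : R | 0 <= w]))).
  by rewrite -[_ @^-1` _]setTI; apply: mfst => //; exact: measurableC.
have mN : measurable N by exact: measurableU.
have N0 : pi N = 0%E.
  apply: null_set_setU => //; rewrite -[RHS]nuZ -pinu//; exact: measurableC.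
apply: (le_Eext_off mN N0) => -[[v w] [vh wh]].
move=> /not_orP[/contrapT[j _ [/= vX vhX]] /contrapT Zw].
rewrite /H /= fE//= /on_atoms mem_set; last by exists j.
rewrite mulr1 -EFinD /cost/=.
have w0 : 0 <= w by case: Zw.
case: j vX vhX => [i|] /= -> ->; rewrite eqxx/=.
  rewrite ifT; last by apply/existsP; exists i.
  rewrite azh bzh.
  have := (ABP _ (yphi i)).1 ((1 - eps) * w).
  move=> /(@lee_wpmul2l _ ((1 - eps)^-1)%:E); rewrite lee_fin invr_ge0 (ltW Neps_gt0).
  move=> /(_ isT); apply: le_trans; rewrite -EFinM lee_fin le_eqVlt; apply/orP; left.
  by apply/eqP; field; rewrite gt_eqF.
rewrite ifF; last by apply/negbTE/existsPn => i; exact: zn1_new.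
by rewrite azn1 bzn1 addr0 EFinM lee_wpmul2r// lee_fin.
Qed.

End problem.

(** * Equality of the two optimal values *)

Unset Implicit Arguments.
Set Strict Implicit.

Theorem mainTheorem3 (R : realType) (d n : nat)
    (Z : set 'rV[R]_d) (l : 'rV[R]_d -> R) (phi : R -> \bar R)
    (r eps : R) (zh : 'I_n -> 'rV[R]_d) (zn1 : 'rV[R]_d) :
  (0 < n)%N ->
  compact Z -> convex_set (Z : set (convex_lmodType 'rV[R]_d)) ->
  usc_on Z l ->
  entropy_fun phi ->
  0 <= r -> 0 < eps < 1 ->
  (forall i, Z (zh i)) ->
  Z zn1 -> (forall z, Z z -> l z <= l zn1) ->
  (forall i, zn1 != zh i) ->
  ereal_sup [set v | exists nu : probability (Rd R d * R)%type R,
     [/\ nu (~` ((Z : set (Rd R d)) `*` [set w : R | 0 <= w])) = 0%E,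
         (OT_moment (cost phi eps zh zn1) nu (nuhat eps zh zn1) <= r%:E)%E
       & v = Eext nu (fun x => (l x.1 * x.2)%:E)]]
  = ereal_sup [set v | exists mu : probability (Rd R d) R,
     [/\ mu (~` (Z : set (Rd R d))) = 0%E,
         (phi_div phi mu (muhat zh) <= r%:E)%E
       & v = Eext mu (fun z => (l z)%:E)]].
Proof.
move=> n0 cZ _ _ ent _ eps01 Zzh Zzn1 zmax znew.
apply/eqP; rewrite eq_le; apply/andP; split; apply: ge_ereal_sup.
  move=> _ [nu [nuZ nur ->]].
  have [p [pfeas ->]] :=
    transport_feasible l n0 cZ ent eps01 znew nuZ nur.
  by apply: ereal_sup_ubound; exact: (feasible_divergence l ent Zzh Zzn1 znew).
move=> _ [mu [muZ mur ->]].
have [p [pfeas /le_trans]] :=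
  divergence_feasible n0 cZ ent zmax znew muZ mur.
apply; apply: ereal_sup_ubound.
exact: (feasible_transport l n0 ent eps01 Zzh Zzn1 znew).
Qed.
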